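(* The functor $fm_g:\mathbf{Graded\ Fuzzy\ TopSys}\longrightarrow\mathbf{Graded\ Frm}^{op}$ is the left adjoint to the functor $S_g:\mathbf{Graded\ Frm}^{op}\longrightarrow\mathbf{Graded\ Fuzzy\ TopSys}$.
   Context: Conventions. On $[0,1]$, $\wedge$ is minimum; infima and suprema of grades are taken in $[0,1]$. Graded frames. A graded frame $(A,R)$ is a tuple $(A,\top,\wedge,\bigvee,R)$ with $A$ a non-empty set, $\top\in A$, $\wedge$ a binary operation on $A$, $\bigvee$ an operation on arbitrary subsets of $A$, and $R:A\times A\to[0,1]$ a fuzzy relation, such that for all $a,b,c\in A$, $S\subseteq A$: (1) $R(a,a)=1$; (2) $R(a,b)=1=R(b,a)$ implies $a=b$; (3) $R(a,b)\wedge R(b,c)\le R(a,c)$; (4) $R(a\wedge b,a)=1=R(a\wedge b,b)$; (5) $R(a,\top)=1$; (6) $R(a,b)\wedge R(a,c)=R(a,b\wedge c)$; (7) $R(a,\bigvee S)=1$ if $a\in S$; (8) $\inf\{R(a,b)\mid a\in S\}=R(\bigvee S,b)$; (9) $R(a\wedge\bigvee S,\bigvee\{a\wedge b\mid b\in S\})=1$. A graded frame homomorphism $f:(A,R)\to(B,R')$ is a map $f:A\to B$ with (i) $f(a_1\wedge a_2)=f(a_1)\wedge f(a_2)$; (ii) $f(\bigvee_i a_i)=\sup_i\{f(a_i)\}$, where $\sup$ is the join in $B$; (iii) $R(a_1,a_2)\le R'(f(a_1),f(a_2))$. $\mathbf{Graded\ Frm}$ is the category of graded frames and graded frame homomorphisms;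 $\mathbf{Graded\ Frm}^{op}$ is its opposite. Systems. A graded fuzzy topological system $(X,\models,A,R)$ consists of a nonempty set $X$, a graded frame $(A,R)$ and a fuzzy relation $\models$ from $X$ to $A$, with values $gr(x\models a)\in[0,1]$, such that: (1) $gr(x\models a)\wedge R(a,b)\le gr(x\models b)$; (2) $gr(x\models\bigwedge S)=\inf\{gr(x\models a)\mid a\in S\}$ for every finite subset $S$ of $A$, including the empty set; (3) $gr(x\models\bigvee S)=\sup\{gr(x\models a)\mid a\in S\}$ for every $S\subseteq A$. The category $\mathbf{Graded\ Fuzzy\ TopSys}$ has these as objects; a morphism $(f_1,f_2):(X,\models,A,R)\to(Y,\models',B,R')$ consists of a function $f_1:X\to Y$ and a graded frame homomorphism $f_2:(B,R')\to(A,R)$ with $gr(x\models f_2(b))=gr(f_1(x)\models' b)$ for all $x\in X$, $b\in B$. Identities are $(id_X,id_A)$ and composition is $(g_1,g_2)\circ(f_1,f_2)=(g_1\circ f_1,f_2\circ g_2)$. Functors. $fm_g(X,\models,A,R)=(A,R)$ and $fm_g(f_1,f_2)=f_2$. Let $R^*:[0,1]\times[0,1]\to[0,1]$ be the Gödel arrow, $R^*(a,b)=1$ if $a\le b$ and $R^*(a,b)=b$ if $a>b$; $([0,1],R^* )$ is regarded as a graded frame with top $1$, meet $\min$ and join $\sup$. Let $Hom_g((A,R),([0,1],R^* ))$ be the set of graded frame homomorphisms $v:(A,R)\to([0,1],R^* )$. Then $S_g((A,R))=(Hom_g((A,R),([0,1],R^* )),\models_*,A,R)$ with $gr(v\models_*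 a)=v(a)$, and for a graded frame homomorphism $f:(B,R')\to(A,R)$, $S_g(f)=(\_\circ f,f)$, where $\_\circ f$ sends $v$ to $v\circ f$.
   Formalization: As the constant 0 is a homomorphism, S_g(A,R) violates system axiom (2) for the empty set; the adjunction is proved in two versions: axiom (2) only for nonempty finite S, or all homomorphisms also preserve top and X may be empty. *)

(* Defs.v *)
From Stdlib Require List.
From HB Require Import structures.
From mathcomp Require Import all_boot all_order all_algebra.
From mathcomp Require Import all_classical all_reals interval_inference.

Set Implicit Arguments.
Unset Strict Implicit.
Unset Printing Implicit Defensive.

Import Order.TTheory GRing.Theory Num.Theory.

Local Open Scope classical_set_scope.
Local Open Scope ring_scope.

Record category := Category {
  obj :> Type;
  hom : obj -> obj -> Type;
  idm : forall a, hom a a;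
  comp : forall a b c, hom b c -> hom a b -> hom a c;
  comp_idl : forall a b (f : hom a b), comp (idm b) f = f;
  comp_idr : forall a b (f : hom a b), comp f (idm a) = f;
  compA : forall a b c d (h : hom c d) (g : hom b c) (f : hom a b),
    comp h (comp g f) = comp (comp h g) f }.

Arguments hom {_}.
Arguments idm {_}.
Arguments comp {_} [_ _ _].

Definition op (C : category) : category :=
  @Category C (fun a b => hom b a) (@idm C) (fun a b c g f => comp f g)
    (fun a b f => comp_idr f) (fun a b f => comp_idl f)
    (fun a b c d h g f => esym (compA f g h)).

Record functor (C D : category) := Functor {
  fobj :> C -> D;
  fmap : forall a b : C, hom a b -> hom (fobj a) (fobj b);
  fmap_id : forall a : C, fmap (idm a) = idm (fobj a);
  fmap_comp : forall (a b c : C) (g : hom b c) (f : hom a b),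
    fmap (comp g f) = comp (fmap g) (fmap f) }.

Arguments fmap {C D} _ [a b].

Definition left_adjoint (C D : category) (F : functor C D) (G : functor D C) :
    Prop :=
  exists phi : forall (c : C) (d : D), hom (F c) d -> hom c (G d),
    (forall c d, bijective (phi c d)) /\
    (forall (c c' : C) (d d' : D) (h : hom c' c) (k : hom d d')
        (f : hom (F c) d),
      phi c' d' (comp k (comp f (fmap F h))) =
      comp (fmap G k) (comp (phi c d f) h)).

Section UnitInterval.
Variable R : realType.
Implicit Types (S : set {i01 R}) (a b c : {i01 R}).

Definition i01_zero : {i01 R} := 0%:i01.
Definition i01_one : {i01 R} := 1%:i01.

Let sup_set S : set R := [set x%:num | x in S] `|` [set 0].
Let inf_set S : set R := [set x%:num | x in S] `|` [set 1].

Let sup_set_ub S : ubound (sup_set S) 1.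
Proof. by move=> _ [[x _ <-]|->]; rewrite ?ler01. Qed.

Let inf_set_lb S : lbound (inf_set S) 0.
Proof. by move=> _ [[x _ <-]|->]; rewrite ?ler01. Qed.

Let has_sup_set S : has_sup (sup_set S).
Proof. by split; [exists 0; right | exists 1; apply: sup_set_ub]. Qed.

Let has_inf_set S : has_inf (inf_set S).
Proof. by split; [exists 1; right | exists 0; apply: inf_set_lb]. Qed.

Fact isup_ge0 S : 0 <= sup (sup_set S).
Proof. by apply: ub_le_sup; [case: (has_sup_set S) | right]. Qed.

Fact isup_le1 S : sup (sup_set S) <= 1.
Proof. by apply: ge_sup; [case: (has_sup_set S) | apply: sup_set_ub]. Qed.

Fact iinf_ge0 S : 0 <= inf (inf_set S).
Proof. by apply: lb_le_inf; [case: (has_inf_set S) | apply: inf_set_lb]. Qed.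

Fact iinf_le1 S : inf (inf_set S) <= 1.
Proof. by apply: ge_inf; [case: (has_inf_set S) | right]. Qed.

(* Adding 0 (resp. 1) to the set makes the supremum (resp. infimum) of the
   empty set the one taken in [0,1], and changes nothing otherwise. *)
Definition isup S : {i01 R} := Itv01 (isup_ge0 S) (isup_le1 S).
Definition iinf S : {i01 R} := Itv01 (iinf_ge0 S) (iinf_le1 S).

Lemma i01_ge0 a : i01_zero <= a.
Proof. by rewrite -num_le/=. Qed.

Lemma i01_le1 a : a <= i01_one.
Proof. by rewrite -num_le/=. Qed.

Lemma isup_leP S c : isup S <= c <-> forall a, S a -> a <= c.
Proof.
split=> [Sc a Sa|Sc].
  apply: le_trans Sc; rewrite -num_le/=; apply: ub_le_sup.
    by case: (has_sup_set S).
  by left; exists a.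
rewrite -num_le/=; apply: ge_sup; first by case: (has_sup_set S).
by move=> _ [[a Sa <-]|->]; rewrite ?num_le ?Sc.
Qed.

Lemma le_iinfP S c : c <= iinf S <-> forall a, S a -> c <= a.
Proof.
split=> [cS a Sa|cS].
  apply: (le_trans cS); rewrite -num_le/=; apply: ge_inf.
    by case: (has_inf_set S).
  by left; exists a.
rewrite -num_le/=; apply: lb_le_inf; first by case: (has_inf_set S).
by move=> _ [[a Sa <-]|->]; rewrite ?num_le ?cS.
Qed.

Lemma min_isup_leP a S c :
  Order.min a (isup S) <= c <-> forall b, S b -> Order.min a b <= c.
Proof.
rewrite ge_min; split.
  case/orP=> [ac b _|/isup_leP Sc b Sb]; rewrite ge_min ?ac//.
  by rewrite (Sc b) ?orbT.
move=> Sc; case: (boolP (a <= c)) => //= ac.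
by apply/isup_leP => b Sb; have := Sc b Sb; rewrite ge_min (negbTE ac).
Qed.

Definition godel a b : {i01 R} := if a <= b then i01_one else b.

Lemma le_godelP c a b : (c <= godel a b) = (Order.min c a <= b).
Proof.
rewrite /godel ge_min; case: ifP => _; first by rewrite orbT i01_le1.
by rewrite orbF.
Qed.

Lemma godel1P a b : godel a b = i01_one <-> a <= b.
Proof.
split=> [g1|ab]; last by rewrite /godel ab.
have := le_godelP i01_one a b; rewrite g1 lexx => /esym; rewrite ge_min.
by case/orP=> // /(le_trans (i01_le1 a)).
Qed.

Lemma i01_eqP a b : (forall c, c <= a <-> c <= b) -> a = b.
Proof.
move=> ab; apply/eqP; rewrite eq_le.
by apply/andP; split; [apply/ab | apply/ab].
Qed.

End UnitInterval.

Arguments i01_zero {R}.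
Arguments i01_one {R}.

Record graded_frame (R : realType) := GradedFrame {
  gf_sort :> Type;
  gf_top : gf_sort;
  gf_meet : gf_sort -> gf_sort -> gf_sort;
  gf_join : set gf_sort -> gf_sort;
  gf_rel : gf_sort -> gf_sort -> {i01 R};
  gf_rel_refl : forall a, gf_rel a a = i01_one;
  gf_rel_anti : forall a b,
    gf_rel a b = i01_one -> gf_rel b a = i01_one -> a = b;
  gf_rel_trans : forall a b c,
    Order.min (gf_rel a b) (gf_rel b c) <= gf_rel a c;
  gf_rel_meetl : forall a b, gf_rel (gf_meet a b) a = i01_one;
  gf_rel_meetr : forall a b, gf_rel (gf_meet a b) b = i01_one;
  gf_rel_top : forall a, gf_rel a gf_top = i01_one;
  gf_rel_meet : forall a b c,
    Order.min (gf_rel a b) (gf_rel a c) = gf_rel a (gf_meet b c);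
  gf_rel_mem_join : forall (S : set gf_sort) a,
    S a -> gf_rel a (gf_join S) = i01_one;
  gf_rel_join : forall (S : set gf_sort) b,
    iinf [set gf_rel a b | a in S] = gf_rel (gf_join S) b;
  gf_rel_distr : forall a (S : set gf_sort),
    gf_rel (gf_meet a (gf_join S)) (gf_join [set gf_meet a b | b in S]) =
    i01_one }.

Arguments gf_top {R g}.
Arguments gf_meet {R g}.
Arguments gf_join {R g}.
Arguments gf_rel {R g}.

(* The meet of the finite set enumerated by [s]; the empty meet is the top. *)
Definition gf_finmeet (R : realType) (A : graded_frame R) (s : seq A) : A :=
  foldr gf_meet gf_top s.

(* If homomorphisms are only asked to preserve binary meets, then the constant
   map 0 (see [zero_point]) is a homomorphism to [0,1], and as a point it
   violates the clause gr(x |= top) = 1 that the empty meet imposes on systems: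
   the points of a graded frame do not form a system.  So the empty meet has to
   be treated alike in homomorphisms and in systems, and the boolean [e] tells
   whether it is counted:
   - [e = false]: homomorphisms preserve binary meets and arbitrary joins, and
     systems are constrained on the meets of nonempty finite sets;
   - [e = true]: homomorphisms preserve the top, and systems are constrained on
     the meets of all finite sets.  Then some graded frames have no point (the
     one-element one, for instance), so the set underlying a system may be
     empty. *)
Record gf_hom (R : realType) (e : bool) (A B : graded_frame R) := GFHom {
  gf_fun :> A -> B;
  gf_hom_meet : forall a b, gf_fun (gf_meet a b) = gf_meet (gf_fun a) (gf_fun b);
  gf_hom_top : e -> gf_fun gf_top = gf_top;
  gf_hom_join : forall S : set A, gf_fun (gf_join S) = gf_join (gf_fun @` S);
  gf_hom_rel : forall a b, gf_rel a b <= gf_rel (gf_fun a) (gf_fun b) }.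

Lemma gf_hom_eq (R : realType) (e : bool) (A B : graded_frame R)
  (f g : gf_hom e A B) : gf_fun f = gf_fun g -> f = g.
Proof.
case: f g => [f f1 f2 f3 f4] [g g1 g2 g3 g4] /= fg; subst g.
by congr GFHom; exact: Prop_irrelevance.
Qed.

Section GradedFrm.
Variables (R : realType) (e : bool).

Definition gf_id (A : graded_frame R) : gf_hom e A A.
Proof.
apply: (@GFHom R e A A (fun a => a)) => // S.
by rewrite image_id.
Defined.

Definition gf_comp (A B C : graded_frame R) (g : gf_hom e B C)
  (f : gf_hom e A B) : gf_hom e A C.
Proof.
apply: (@GFHom R e A C (fun a => g (f a))).
- by move=> a b; rewrite !gf_hom_meet.
- by move=> e1; rewrite !gf_hom_top.
- by move=> S; rewrite !gf_hom_join image_comp.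
- by move=> a b; apply: le_trans (gf_hom_rel f a b) (gf_hom_rel g _ _).
Defined.

Definition GradedFrm : category.
Proof.
apply: (@Category (graded_frame R) (@gf_hom R e) gf_id gf_comp);
  by move=> *; apply: gf_hom_eq.
Defined.

End GradedFrm.

Definition i01_frame (R : realType) : graded_frame R.
Proof.
apply: (@GradedFrame R {i01 R} i01_one Order.min (@isup R) (@godel R)).
- by move=> a; apply/godel1P.
- move=> a b /godel1P ab /godel1P ba.
  by apply/eqP; rewrite eq_le ab.
- move=> a b c; rewrite le_godelP minAC.
  rewrite [X in Order.min X _](_ : _ = Order.min (godel a b) a) //.
  apply: (@le_trans _ _ (Order.min b (godel b c))).
    rewrite le_min !ge_min lexx orbT andbT -ge_min.
    by rewrite -le_godelP lexx.
  by rewrite minC -le_godelP.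
- by move=> a b; apply/godel1P; rewrite ge_min lexx.
- by move=> a b; apply/godel1P; rewrite ge_min lexx orbT.
- by move=> a; apply/godel1P; apply: i01_le1.
- move=> a b c; apply: i01_eqP => d.
  by rewrite le_min !le_godelP le_min.
- by move=> S a Sa; apply/godel1P; move: a Sa; apply/isup_leP.
- move=> S b; apply: i01_eqP => d; rewrite le_godelP.
  split=> [/le_iinfP dS|/min_isup_leP dS].
    apply/min_isup_leP => a Sa; rewrite -le_godelP; apply: dS.
    by exists a.
  by apply/le_iinfP => _ [a Sa <-]; rewrite le_godelP; exact: dS.
- move=> a S; apply/godel1P; apply/min_isup_leP => b Sb.
  suff : forall c, [set Order.min a b | b in S] c ->
           c <= isup [set Order.min a b | b in S] by apply; exists b.
  exact/isup_leP.
Defined.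

Record graded_system (R : realType) (e : bool) := GradedSystem {
  gs_pt : Type;
  gs_frame : graded_frame R;
  gs_gr : gs_pt -> gs_frame -> {i01 R};
  gs_inhabited : ~~ e -> inhabited gs_pt;
  gs_rel : forall x a b, Order.min (gs_gr x a) (gf_rel a b) <= gs_gr x b;
  gs_meet : forall x (s : seq gs_frame), (s <> [::] \/ e) ->
    gs_gr x (gf_finmeet s) = iinf [set gs_gr x a | a in [set a | List.In a s]];
  gs_join : forall x (S : set gs_frame),
    gs_gr x (gf_join S) = isup [set gs_gr x a | a in S] }.

Arguments gs_gr {R e} g.

Record gs_hom (R : realType) (e : bool) (X Y : graded_system R e) := GSHom {
  gs_fun : gs_pt X -> gs_pt Y;
  gs_ffun : gf_hom e (gs_frame Y) (gs_frame X);
  gs_homP : forall x b, gs_gr X x (gs_ffun b) = gs_gr Y (gs_fun x) b }.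

Lemma gs_hom_eq (R : realType) (e : bool) (X Y : graded_system R e)
  (f g : gs_hom X Y) : gs_fun f = gs_fun g -> gs_ffun f = gs_ffun g -> f = g.
Proof.
case: f g => [f1 f2 fP] [g1 g2 gP] /= E1 E2; subst g1 g2.
by congr GSHom; exact: Prop_irrelevance.
Qed.

Section GradedFuzzyTopSys.
Variables (R : realType) (e : bool).

Definition gs_id (X : graded_system R e) : gs_hom X X :=
  @GSHom R e X X (fun x => x) (gf_id e (gs_frame X)) (fun x b => erefl).

Definition gs_comp (X Y Z : graded_system R e) (g : gs_hom Y Z)
  (f : gs_hom X Y) : gs_hom X Z.
Proof.
apply: (@GSHom R e X Z (fun x => gs_fun g (gs_fun f x))
         (gf_comp (gs_ffun f) (gs_ffun g))).
by move=> x b; rewrite /= (gs_homP f) (gs_homP g).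
Defined.

Definition GradedFuzzyTopSys : category.
Proof.
apply: (@Category (graded_system R e) (@gs_hom R e) gs_id gs_comp);
  by move=> *; apply: gs_hom_eq => //; apply: gf_hom_eq.
Defined.

Definition fm_g : functor GradedFuzzyTopSys (op (GradedFrm R e)) :=
  @Functor GradedFuzzyTopSys (op (GradedFrm R e))
    (fun X => gs_frame X) (fun X Y f => gs_ffun f)
    (fun X => erefl) (fun X Y Z g f => erefl).

Definition Hom_g (A : graded_frame R) : Type := gf_hom e A (i01_frame R).

Definition zero_point (A : graded_frame R) : ~~ e -> Hom_g A.
Proof.
move=> ne; apply: (@GFHom R e A (i01_frame R) (fun=> i01_zero)).
- by move=> a b; rewrite /= minxx.
- by rewrite (negbTE ne).
- move=> S; apply/eqP; rewrite eq_le i01_ge0.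
  by apply/isup_leP => _ [a _ <-].
- by move=> a b; rewrite /= le_godelP ge_min lexx orbT.
Defined.

Fact S_g_meet (A : graded_frame R) (v : Hom_g A) (s : seq A) :
  (s <> [::] \/ e) ->
  v (gf_finmeet s) = iinf [set v a | a in [set a | List.In a s]].
Proof.
have meet1 (a : A) : gf_meet a gf_top = a.
  apply: gf_rel_anti; first exact: gf_rel_meetl.
  by rewrite -gf_rel_meet gf_rel_refl gf_rel_top minxx.
have cons a (t : seq A) : [set v b | b in [set b | List.In b (a :: t)]] =
    v a |` [set v b | b in [set b | List.In b t]].
  apply/seteqP; split=> [_ [b [->|tb] <-]|_ [->|[b tb <-]]]; first by left.
  - by right; exists b.
  - by exists a => //; left.
  - by exists b => //; right.
have step a (t : seq A) :
    v (gf_finmeet t) = iinf [set v a | a in [set a | List.In a t]] ->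
    v (gf_finmeet (a :: t)) =
      iinf [set v b | b in [set b | List.In b (a :: t)]].
  move=> IH; rewrite [LHS]gf_hom_meet [v (foldr _ _ _)]IH cons /=.
  apply: i01_eqP => c; rewrite le_min; split.
    by case/andP=> ca /le_iinfP ct; apply/le_iinfP => b [->//|/ct].
  move=> /le_iinfP ct; apply/andP; split; first by apply: ct; left.
  by apply/le_iinfP => b tb; apply: ct; right.
have top1 : e -> v (gf_finmeet [::]) =
    iinf [set v a | a in [set a | List.In a [::]]].
  move=> e1; rewrite /= (gf_hom_top v e1) /=; apply: i01_eqP => c.
  by rewrite i01_le1; split=> // _; apply/le_iinfP => b [].
case=> [sn|e1]; last by elim: s => [|a s IH]; [exact: top1 | exact: step].
elim: s sn => [//|a [|b s] IH _]; last by apply: step; exact: IH.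
rewrite cons [gf_finmeet _]/= meet1; apply: i01_eqP => c; split.
  by move=> ca; apply/le_iinfP => b [->//|[d []]].
by move=> /le_iinfP; apply; left.
Qed.

Definition S_g_obj (A : graded_frame R) : graded_system R e.
Proof.
apply: (@GradedSystem R e (Hom_g A) A (fun v a => v a)).
- by move=> ne; constructor; exact: zero_point.
- move=> v a b; rewrite minC -le_godelP.
  exact: (gf_hom_rel v a b).
- exact: S_g_meet.
- by move=> v S; apply: (gf_hom_join v S).
Defined.

Definition S_g_hom (A B : graded_frame R) (f : gf_hom e B A) :
    gs_hom (S_g_obj A) (S_g_obj B) :=
  @GSHom R e (S_g_obj A) (S_g_obj B) (fun v : Hom_g A => gf_comp v f) f
    (fun v b => erefl).

Definition S_g : functor (op (GradedFrm R e)) GradedFuzzyTopSys.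
Proof.
apply: (@Functor (op (GradedFrm R e)) GradedFuzzyTopSys S_g_obj
          (fun A B f => S_g_hom f)).
- by move=> A; apply: gs_hom_eq => //; apply: funext => v; apply: gf_hom_eq.
- by move=> A B C g f; apply: gs_hom_eq => //; apply: funext => v;
    apply: gf_hom_eq.
Defined.

End GradedFuzzyTopSys.

(* Main.v *)
Require Import Defs.
From mathcomp Require Import all_boot all_order all_algebra.
From mathcomp Require Import all_classical all_reals interval_inference.

(** The unit at a system X is (p, id), where p sends a point x to the grade map
    a |-> gr(x |= a), which is a graded frame homomorphism to [0,1].  The
    transpose of a frame homomorphism f is therefore (_ o f, f) o (p, id).
    Conversely, the condition on morphisms of systems forces the point component
    of a morphism into S_g(A) to be the one given by its frame component. *)

Set Implicit Arguments.
Unset Strict Implicit.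
Unset Printing Implicit Defensive.

Import Order.TTheory.
Local Open Scope classical_set_scope.
Local Open Scope ring_scope.

Lemma gf_meetx1 (R : realType) (A : graded_frame R) (a : A) :
  gf_meet a gf_top = a.
Proof.
apply: gf_rel_anti; first exact: gf_rel_meetl.
by rewrite -gf_rel_meet gf_rel_refl gf_rel_top minxx.
Qed.

(** The list [[:: a; b]] is nonempty, so [gs_meet] applies to it for either value of [e];
    [gf_meetx1] removes the top that ends the fold. *)
Lemma gs_gr_meet (R : realType) (e : bool) (X : graded_system R e)
    (x : gs_pt X) (a b : gs_frame X) :
  gs_gr X x (gf_meet a b) = Order.min (gs_gr X x a) (gs_gr X x b).
Proof.
have := @gs_meet R e X x [:: a; b] (or_introl _).
rewrite /gf_finmeet /= gf_meetx1 => -> //.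
apply: i01_eqP => c; rewrite le_min; split=> [/le_iinfP cab|/andP[ca cb]].
  by rewrite !cab //; [exists b => //=; right; left | exists a => //=; left].
by apply/le_iinfP => _ [_ [<-|[<-|[]]] <-].
Qed.

Lemma gs_gr_top (R : realType) (e : bool) (X : graded_system R e)
    (x : gs_pt X) :
  e -> gs_gr X x gf_top = i01_one.
Proof.
move=> e1; rewrite (@gs_meet R e X x [::] (or_intror e1)).
apply: i01_eqP => c; rewrite i01_le1; split=> // _.
by apply/le_iinfP => _ [_ []].
Qed.

(** By residuation of [godel] with the minimum, this is axiom [gs_rel]. *)
Lemma gs_gr_godel (R : realType) (e : bool) (X : graded_system R e)
    (x : gs_pt X) (a b : gs_frame X) :
  gf_rel a b <= godel (gs_gr X x a) (gs_gr X x b).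
Proof. by rewrite le_godelP minC gs_rel. Qed.

Definition gs_point (R : realType) (e : bool) (X : graded_system R e)
    (x : gs_pt X) : Hom_g e (gs_frame X) :=
  @GFHom R e (gs_frame X) (i01_frame R) (gs_gr X x)
    (gs_gr_meet x) (gs_gr_top x) (gs_join x) (gs_gr_godel x).

Definition gs_transpose (R : realType) (e : bool) (X : graded_system R e)
    (A : graded_frame R) (f : gf_hom e A (gs_frame X)) :
    gs_hom X (S_g_obj e A) :=
  @GSHom R e X (S_g_obj e A) (fun x => gf_comp (gs_point x) f) f
    (fun x a => erefl).

Lemma gs_transposeK (R : realType) (e : bool) (X : graded_system R e)
    (A : graded_frame R) (g : gs_hom X (S_g_obj e A)) :
  gs_transpose (gs_ffun g) = g.
Proof.
apply: gs_hom_eq => //; apply: funext => x; apply: gf_hom_eq.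
by apply: funext => a; exact: gs_homP g x a.
Qed.

Theorem lemma4p1 (R : realType) (e : bool) : left_adjoint (fm_g R e) (S_g R e).
Proof.
exists (@gs_transpose R e); split=> [X A|X X' A A' h k f].
  (* The inverse takes the frame component; it recovers [f] by conversion. *)
  by exists (@gs_ffun R e X (S_g_obj e A)) => [f|g]; last exact: gs_transposeK.
apply: gs_hom_eq => //; apply: funext => x; apply: gf_hom_eq.
(* The frame components agree by conversion. At [x] and [a], naturality compares the grade of
   [h (f (k a))] at [x] with that of [f (k a)] at the image of [x]. *)
by apply: funext => a; exact: (gs_homP h x (f (k a))).
Qed.
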